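(* Let $\mathbb{F}$ be a field of characteristic $3$. Let $C\in\mathbb{M}_3(\mathbb{F})$ be a companion matrix such that $\mathrm{Tr}(C)=1$ and none of $0$, $1$, $-1$ is an eigenvalue of $C$. If $E,N\in\mathbb{M}_3(\mathbb{F})$ are matrices such that $C=E+N$, $E^3=E$ and $N^3=0$, then $N^2\neq 0$.
   Context: $\mathbb{M}_3(\mathbb{F})$ denotes the ring of $3\times 3$ matrices over $\mathbb{F}$ and $\mathrm{Tr}$ is the trace. A $3\times 3$ companion matrix over $\mathbb{F}$ is a matrix of the form $\begin{pmatrix}0&0&-c_0\\1&0&-c_1\\0&1&-c_2\end{pmatrix}$ with $c_0,c_1,c_2\in\mathbb{F}$. *)

(* Defs.v *)
From mathcomp Require Import all_boot all_algebra.

Set Implicit Arguments.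
Unset Strict Implicit.
Unset Printing Implicit Defensive.

Import GRing.Theory.
Local Open Scope ring_scope.

(*               / 0 0 -c0 \
   companion3 = | 1 0 -c1 |   (coefficients in the last column; the library's
                \ 0 1 -c2 /   companionmx has them in the last row)          *)
Definition companion3 (R : nzRingType) (c0 c1 c2 : R) : 'M[R]_3 :=
  \matrix_(i < 3, j < 3)
    if j == 2 :> nat then - [:: c0; c1; c2]`_i else (i == j.+1 :> nat)%:R.

Definition is_companion3 (R : nzRingType) (C : 'M[R]_3) : Prop :=
  exists c0 c1 c2 : R, C = companion3 c0 c1 c2.

Lemma companion3E (R : nzRingType) (c0 c1 c2 : R) :
  companion3 c0 c1 c2 = (companionmx [:: c0; c1; c2; 1])^T.
Proof.
by apply/matrixP=> -[[|[|[|//]]] ?] [[|[|[|//]]] ?]; rewrite !mxE.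
Qed.

(* Main.v *)
(* Suppose N^2 = 0. Then N has rank at most 1 and trace 0. For a in {0, 1, -1}
   the matrix C - a = (E - a) + N is invertible, so E - a has rank at least 2.
   As E (E - 1) (E + 1) = 0, no factor E - a can be invertible, since the product
   of the other two would vanish, against Sylvester's bound 2 + 2 <= 3. Hence the
   eigenvalues of E are exactly 0, 1, -1, so 1 = Tr C = Tr E = 0. *)
Require Import Defs.
From mathcomp Require Import all_boot all_algebra.
From mathcomp Require Import ring.

Import GRing.Theory.
Local Open Scope ring_scope.

(** In the rank factorization of [A] as [col_base A *m row_base A], the outer factors cancel from
    [A *m A = 0], leaving [row_base A *m col_base A = 0], whose trace is that of [A] by
    cyclicity. *)
Lemma mxtrace_sqr0 (F : fieldType) (n : nat) (A : 'M[F]_n) :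
  A *m A = 0 -> \tr A = 0.
Proof.
move=> A20.
rewrite -(mulmx_base A) mxtrace_mulC.
suff -> : row_base A *m col_base A = 0 by rewrite mxtrace0.
apply: (row_full_inj (col_base_full A)).
apply: (row_free_inj (row_base_free A)).
by rewrite mulmxA mulmx_base -mulmxA mulmx_base A20 mulmx0 mul0mx.
Qed.

Lemma mxrank_unit (F : fieldType) (n : nat) (A : 'M[F]_n) :
  A \in unitmx -> \rank A = n.
Proof. by rewrite -row_free_unit => /eqP. Qed.

Lemma not_eigenvalue_unitmx (F : fieldType) (n : nat) (A : 'M[F]_n) (a : F) :
  ~~ eigenvalue A a = (A - a%:M \in unitmx).
Proof. by rewrite negbK kermx_eq0 row_free_unit. Qed.

Lemma rank_sub_not_eigenvalue (F : fieldType) (n : nat) (A B : 'M[F]_n) (a : F) :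
  ~~ eigenvalue (A + B) a ->
  (n <= \rank (A - a%:M)%R + \rank B)%N.
Proof.
rewrite not_eigenvalue_unitmx addrAC => /mxrank_unit {1}<-.
exact: mxrank_add.
Qed.

Lemma eigenvalue_of_mul0 (F : fieldType) (n : nat) (A X Y : 'M[F]_n) (a : F) :
  (A - a%:M) *m (X *m Y) = 0 -> (n < \rank X + \rank Y)%N -> eigenvalue A a.
Proof.
move=> AXY0 ltn_rank; rewrite -[eigenvalue A a]negbK not_eigenvalue_unitmx.
apply: contraL ltn_rank => Aunit; rewrite -leqNgt.
apply: mulmx0_rank_max.
by rewrite -(mulKmx Aunit (X *m Y)) AXY0 mulmx0.
Qed.

(** The characteristic polynomial is monic of degree 3 with three distinct roots, so it is the
    product of the linear factors; compare the coefficients of X^2. *)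
Lemma mxtrace_distinct_eigenvalues (F : fieldType) (A : 'M[F]_3) (a b c : F) :
  uniq [:: a; b; c] -> all (eigenvalue A) [:: a; b; c] -> \tr A = a + b + c.
Proof.
move=> uabc eabc.
have rabc : all (root (char_poly A)) [:: a; b; c].
  by apply: sub_all eabc => x; rewrite eigenvalue_root_char.
have := @all_roots_prod_XsubC _ _ [:: a; b; c] (size_char_poly A) rabc.
rewrite uniq_rootsE => /(_ uabc).
rewrite (monicP (char_poly_monic A)) scale1r => defp.
apply: oppr_inj; rewrite -char_poly_trace // defp.
rewrite (@coefPn_prod_XsubC _ [:: a; b; c]) //.
by rewrite !big_cons big_nil addr0 addrA.
Qed.

Theorem proposition13 (F : fieldType) (charF : 3%N \in [pchar F])
    (C : 'M[F]_3) (companionC : is_companion3 C) (trC : \tr C = 1)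
    (eig0 : ~~ eigenvalue C 0) (eig1 : ~~ eigenvalue C 1)
    (eigN1 : ~~ eigenvalue C (- 1))
    (E N : 'M[F]_3) (defC : C = E + N) (E3 : E ^+ 3 = E) (N3 : N ^+ 3 = 0) :
  N ^+ 2 <> 0.
Proof.
move=> N2; have NN0 : N *m N = 0 by rewrite -[RHS]N2.
have rkN : (\rank N <= 1)%N.
  (* Sylvester's bound for [N *m N = 0]: twice the rank is at most 3. *)
  have := mulmx0_rank_max NN0; by case: (\rank N) => [|[|r]] //; rewrite !addnS.
have rkE a : ~~ eigenvalue C a -> (1 < \rank (E - a%:M)%R)%N.
  rewrite defC => /rank_sub_not_eigenvalue rk3.
  by rewrite -(leq_add2r 1); apply: leq_trans rk3 _; rewrite leq_add2l.
have eigE a b c : ~~ eigenvalue C b -> ~~ eigenvalue C c ->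
    ('X - a%:P) * (('X - b%:P) * ('X - c%:P)) = 'X^3 - 'X -> eigenvalue E a.
  (* Evaluating the polynomial identity at [E] turns its right side into E^3 - E = 0. *)
  move=> /rkE rkb /rkE rkc /(congr1 (horner_mx E)).
  rewrite !(rmorphXn, rmorphB, rmorphM) /= horner_mx_X !horner_mx_C E3 subrr.
  by move=> /eigenvalue_of_mul0; apply; apply: leq_add rkb rkc.
have trE : \tr E = 0 + 1 + - 1.
  apply: mxtrace_distinct_eigenvalues.
    rewrite /= !inE eq_sym oner_eq0 eq_sym oppr_eq0 oner_eq0 /= andbT.
    (* 1 and -1 differ because 3 does not divide 2. *)
    rewrite -subr_eq0 opprK -[1 + 1]/(2%:R).
    by rewrite -(dvdn_pcharf charF).
  rewrite /= andbT; apply/and3P; split.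
  - by apply: (eigE 0 1 (- 1)) => //; rewrite polyC0 polyCN polyC1; ring.
  - by apply: (eigE 1 0 (- 1)) => //; rewrite polyC0 polyCN polyC1; ring.
  - by apply: (eigE (- 1) 0 1) => //; rewrite polyC0 polyCN polyC1; ring.
move/eqP: trC; rewrite defC raddfD /= trE (mxtrace_sqr0 _ _ _ NN0).
by rewrite add0r subrr addr0 eq_sym oner_eq0.
Qed.
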